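(* Let $c>0$ be fixed. Then there exists $n_0$ such that for every $n\ge n_0$ the following holds: if $G$ is a graph on $n$ vertices such that every subset $U\subseteq V(G)$ with $|U|\ge\sqrt{n}$ spans at least $c|U|^2$ edges, then $f(G)\le \frac{638n}{c^3}$.
   Context: For a graph $G$, a family $\mathcal{P}$ of subsets of $E(G)$ is a separating path system of $G$ if every member of $\mathcal{P}$ is (the edge set of) a path in $G$, and for every pair of distinct edges $e,e'\in E(G)$ there is some $P\in\mathcal{P}$ containing exactly one of $e,e'$. $f(G)$ denotes the minimum size of a separating path system of $G$. *)

(* Defs.v *)
From HB Require Import structures.
From mathcomp Require Import all_boot all_order all_algebra.
From mathcomp Require Import boolp reals.
Set Implicit Arguments. Unset Strict Implicit. Unset Printing Implicit Defensive.
Import Order.TTheory GRing.Theory Num.Theory.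

Definition simple_graph (n : nat) (adj : rel 'I_n) : Prop :=
  symmetric adj /\ irreflexive adj.

Definition edges (n : nat) (adj : rel 'I_n) : {set {set 'I_n}} :=
  [set S : {set 'I_n} | [exists x, exists y, adj x y && (S == [set x; y])]].

Fixpoint path_edges (n : nat) (x : 'I_n) (s : seq 'I_n) : {set {set 'I_n}} :=
  match s with
  | [::] => set0
  | y :: s' => [set x; y] |: path_edges y s'
  end.

Definition is_path_edgeset (n : nat) (adj : rel 'I_n) (P : {set {set 'I_n}}) : Prop :=
  exists (x : 'I_n) (s : seq 'I_n),
    [/\ uniq (x :: s), path adj x s & P = path_edges x s].

Definition separating_path_system (n : nat) (adj : rel 'I_n)
    (F : {set {set {set 'I_n}}}) : Prop :=
  (forall P, P \in F -> is_path_edgeset adj P) /\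
  (forall e1 e2, e1 \in edges adj -> e2 \in edges adj -> e1 != e2 ->
     exists2 P, P \in F & (e1 \in P) != (e2 \in P)).

(* Existence of some separating path system (single edges are paths);
   stated as a predicate on sizes. *)
Definition has_sps_of_size (n : nat) (adj : rel 'I_n) (k : nat) : bool :=
  `[< exists F, separating_path_system adj F /\ #|F| = k >].

Lemma has_sps_exists (n : nat) (adj : rel 'I_n) (Hg : simple_graph adj) :
  exists k, has_sps_of_size adj k.
Proof.
case: Hg => Hsym Hirr.
exists #|[set [set S] | S in edges adj]|; apply/asboolP.
exists [set [set S] | S in edges adj]; split => //; split.
- move=> P /imsetP [S] /[!inE] /existsP [x] /existsP [y] /andP [Hxy /eqP ->] ->.
  exists x, [:: y]; split => //=.
  + by rewrite inE andbT; apply/eqP => Exy; move: Hxy; rewrite Exy Hirr.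
  + by rewrite Hxy.
  + by rewrite setU0.
- move=> e1 e2 H1 _ Hne; exists [set e1]; first by apply/imsetP; exists e1.
  by rewrite !in_set1 eqxx (eq_sym e2) (negbTE Hne).
Qed.

Definition f_sps (n : nat) (adj : rel 'I_n) (Hg : simple_graph adj) : nat :=
  ex_minn (has_sps_exists Hg).

Definition spanned_edges (n : nat) (adj : rel 'I_n) (U : {set 'I_n}) : nat :=
  #|[set S in edges adj | S \subset U]|.

(* Main.v *)
Require Import Defs.
From HB Require Import structures.
From mathcomp Require Import all_boot all_order all_algebra.
From mathcomp Require Import boolp reals.
From mathcomp Require Import zify ring lra.
Set Implicit Arguments. Unset Strict Implicit. Unset Printing Implicit Defensive.
Import Order.TTheory GRing.Theory Num.Theory.

(** It is enough to produce O(n / c^3) paths such that every edge e is the exact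
intersection of two of them: some path then contains e and misses any given e'.

Let |U| = m >= sqrt n.  Averaging over the neighbourhoods of the vertices of U
(dependent random choice) gives C in U with |C| >= c m / 4 such that any two
vertices of C are joined by paths of length 4 that avoid any 6T given vertices and
any given edge set of maximum degree at most 2T, where T is about c^2 m / 128.

An edge ab with a in C and b in U is prolonged to the short path a, b, a', where a'
is the successor of a in a fixed cyclic order of the neighbours of b in C.  A greedy
colouring splits these short paths into O(m + |C| / c^2) vertex-disjoint classes of
size at most T, and each class is joined into one path P.  This is repeated with
predecessors in place of successors, but now the path Q through the class of ab
avoids all edges other than ab of the paths P built for the members of that class.
This is possible because the union of at most T paths has maximum degree at most 2T.
Hence P and Q meet exactly in ab.  Edges at a vertex b with at most two neighbours
in C are paths on their own.

This costs O(|C| / c^3) paths and handles all edges of U that meet C; continue with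
U \ C.  Once |U| < sqrt n, fewer than n edges are left. *)

(** * Cardinality bounds and greedy colouring into small classes *)

Lemma card_setU_le (I : finType) (A B : {set I}) : #|A :|: B| <= #|A| + #|B|.
Proof. exact: leq_card_setU. Qed.

Lemma card_bigcup_le_sum (I J : finType) (A : {set I}) (F : I -> {set J}) :
  #|\bigcup_(i in A) F i| <= \sum_(i in A) #|F i|.
Proof.
elim/big_rec2: _ => [|i a B iA le]; first by rewrite cards0.
by apply: leq_trans (card_setU_le _ _) _; rewrite leq_add2l.
Qed.

Lemma card_bigcup_le (I J : finType) (A : {set I}) (F : I -> {set J}) (k : nat) :
  {in A, forall i, #|F i| <= k} -> #|\bigcup_(i in A) F i| <= k * #|A|.
Proof.
move=> Fk; apply: leq_trans (card_bigcup_le_sum _ _) _.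
by rewrite mulnC -sum_nat_const leq_sum.
Qed.

(** Double counting: in-degrees and out-degrees within [S] have the same sum, so the smallest
    in-degree is at most the average out-degree. *)
Lemma exists_small_indegree (I : finType) (r : rel I) (D : nat) (S : {set I}) :
    (forall x, x \in S -> #|[set y in S | r x y]| <= D) -> S != set0 ->
  exists2 x, x \in S & #|[set y in S | r y x]| <= D.
Proof.
move=> out_r S_n0; apply/exists_inP; apply: contraT.
rewrite negb_exists_in => /forall_inP in_r.
have : \sum_(x in S) #|[set y in S | r y x]| <= #|S| * D.
  under eq_bigr do rewrite -sum1dep_card big_mkcondr.
  rewrite exchange_big /= -sum_nat_const leq_sum // => y Sy.
  by rewrite -big_mkcondr sum1dep_card out_r.
suff : #|S| * D < \sum_(x in S) #|[set y in S | r y x]| by lia.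
apply: (@leq_trans (#|S| * D.+1)); first by rewrite ltn_pmul2l ?card_gt0.
by rewrite -sum_nat_const leq_sum // => x /in_r; rewrite -ltnNge.
Qed.

(** Greedy colouring for a relation that need not be symmetric. Remove a vertex [x] of in-degree at
    most [D] and colour the rest. Then [x] is related to at most [2 * D] vertices in either
    direction, and at most [#|S| %/ T] classes are already full, so one colour remains for [x]. *)
Lemma exists_bounded_classes (I : finType) (r : rel I) (D T : nat) (S : {set I}) :
    0 < T -> (forall x, x \in S -> #|[set y in S | r x y]| <= D) ->
  exists col : I -> 'I_(2 * D + #|S| %/ T).+1,
    {in S &, forall x y, col x = col y -> x != y -> ~~ r x y} /\
    (forall k, #|[set x in S | col x == k]| <= T).
Proof.
(* The number of colours is frozen as [K] before the induction, so that smaller sets are coloured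
   with the same palette. *)
move=> T_gt0; move: {-1}(2 * D + #|S| %/ T) (leqnn (2 * D + #|S| %/ T)) => K.
elim/ltn_ind: {S}#|S| {-2}S (erefl #|S|) => c IH S Sc leK out_r.
have [S0|S_n0] := eqVneq S set0.
  exists (fun=> ord0); split=> [x y|k]; first by rewrite S0 inE.
  by rewrite S0; under eq_finset do rewrite inE; rewrite -/set0 cards0.
have [x Sx in_x] := exists_small_indegree out_r S_n0.
have cS : #|S| = #|S :\ x|.+1 by rewrite (cardsD1 x S) Sx.
have [| |y|col [ok_col small_col]] := IH #|S :\ x| _ (S :\ x) erefl.
- by rewrite -Sc cS.
- by apply: leq_trans leK; rewrite leq_add2l leq_div2r // cS.
- rewrite 2!inE => /andP[_ Sy]; apply: leq_trans (out_r _ Sy).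
  by apply/subset_leq_card/subsetP => z; rewrite !inE => /andP[/andP[_ ->] ->].
pose used := [set col y | y in S :\ x & r x y || r y x].
pose full := [set k | #|[set y in S :\ x | col y == k]| == T].
have used_le : #|used| <= 2 * D.
  apply: leq_trans (leq_imset_card _ _) _.
  have sub : [set y in S :\ x | r x y || r y x] \subset
      [set y in S | r x y] :|: [set y in S | r y x].
    by apply/subsetP=> y; rewrite !inE => /andP[/andP[_ ->]].
  have := leq_trans (subset_leq_card sub) (card_setU_le _ _).
  have := out_r _ Sx; rewrite cardsE /=.
  set a := #|_|; set b := #|_|; set d := #|_|; lia.
have full_le : #|full| <= #|S :\ x| %/ T.
  (* Full classes are disjoint and have [T] elements each. *)
  rewrite leq_divRL // -sum_nat_const.
  have -> : \sum_(k in full) T = \sum_(k in full) \sum_(y in S :\ x | col y == k) 1.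
    by apply: eq_bigr => k; rewrite inE sum1dep_card => /eqP.
  rewrite (exchange_big_dep (mem (S :\ x))) /=; last by move=> k y _ /andP[].
  rewrite -sum1_card leq_sum // => y Sy.
  rewrite (eq_bigl (fun k => (k \in full) && (col y == k))); last first.
    by move=> k; rewrite Sy.
  rewrite sum1dep_card -(cards1 (col y)) subset_leq_card //.
  by apply/subsetP=> k; rewrite !inE => /andP[_ /eqP ->].
have [k0 k0P] : exists k, k \notin used :|: full.
  apply/existsP; apply: contraT; rewrite negb_exists => /forallP all_in.
  have : #|'I_K.+1| <= #|used :|: full|.
    by rewrite -cardsT subset_leq_card //; apply/subsetP=> k _; move: (all_in k); rewrite negbK.
  have := card_setU_le used full; have : #|S :\ x| %/ T <= #|S| %/ T by rewrite leq_div2r // cS.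
  move: leK used_le full_le; rewrite card_ord.
  move: (#|S :\ x| %/ T) (#|S| %/ T) #|used| #|full| #|used :|: full| => q1 q2 a b d; lia.
move: k0P; rewrite inE negb_or => /andP[k0_used k0_full].
exists (fun y => if y == x then k0 else col y); split=> [y z Sy Sz|k].
  have free y' : y' \in S -> y' != x -> col y' = k0 -> ~~ r x y' && ~~ r y' x.
    move=> Sy' y'x cy'; rewrite -negb_or; apply: contra k0_used => ry'.
    by apply/imsetP; exists y'; rewrite ?inE ?y'x ?Sy'.
  have [->|yx] := eqVneq y x; have [->|zx] := eqVneq z x.
  - by [].
  - by move=> /esym cz _; have /andP[] := free _ Sz zx cz.
  - by move=> cy _; have /andP[] := free _ Sy yx cy.
  - by apply: ok_col; rewrite !inE ?yx ?zx.
have [->|kk0] := eqVneq k k0.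
  have lt : #|[set y in S :\ x | col y == k0]| < T.
    by rewrite ltn_neqAle small_col andbT; move: k0_full; rewrite inE.
  apply: leq_trans lt; rewrite -(add1n #|_|) -(cards1 x).
  apply: leq_trans (card_setU_le _ _); apply/subset_leq_card/subsetP=> y.
  by rewrite !inE; have [->|yx] := eqVneq y x; rewrite ?eqxx ?(negbTE yx) /=.
apply: leq_trans (small_col k); apply/subset_leq_card/subsetP=> y.
rewrite !inE; have [_|//] := eqVneq y x.
by rewrite eq_sym (negbTE kk0) andbF.
Qed.

(** * Degrees in the edge set of a path *)

Section Pairs.
Variable n : nat.
Implicit Types (x y v : 'I_n) (P : {set {set 'I_n}}).

Lemma eq_set2 x y u v :
  [set x; y] = [set u; v] -> (x = u /\ y = v) \/ (x = v /\ y = u).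
Proof.
move=> E; have : x \in [set u; v] by rewrite -E set21.
have : y \in [set u; v] by rewrite -E set22.
have : u \in [set x; y] by rewrite E set21.
have : v \in [set x; y] by rewrite E set22.
rewrite !inE => /orP[] /eqP ? /orP[] /eqP ? /orP[] /eqP ? /orP[] /eqP ?; subst; tauto.
Qed.

(** The neighbourhood of [v] in the graph with edge set [P]; its cardinality serves as the degree of
    [v]. *)
Definition edge_nbrs v P : {set 'I_n} := [set y | [set v; y] \in P].

Lemma mem_path_edges x s e y : e \in path_edges x s -> y \in e -> y \in x :: s.
Proof.
elim: s x => [|z s IH] x /=; first by rewrite inE.
rewrite !in_setU1 => /orP[/eqP->|/IH yP]; first by rewrite !inE; case/orP=> ->; rewrite ?orbT.
by move/yP; rewrite (in_cons x) => ->; rewrite orbT.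
Qed.

(** The sharper bound 1 at the starting vertex makes the induction work: prepending an edge raises
    the degree of the old start to at most 2. *)
Lemma card_edge_nbrs_path x s v :
  uniq (x :: s) -> #|edge_nbrs v (path_edges x s)| <= 2 - (v == x).
Proof.
elim: s x => [|y s IH] x.
  by move=> _; rewrite /edge_nbrs; under eq_finset do rewrite inE; rewrite -/set0 cards0.
rewrite cons_uniq => /andP[xs us].
have out : x \notin y :: s -> edge_nbrs x (path_edges y s) = set0.
  move=> xys; apply/setP=> z; rewrite !inE; apply: contraNF xys => /mem_path_edges; apply.
  exact: set21.
have sub : edge_nbrs v (path_edges x (y :: s)) \subset
    [set z | [set v; z] == [set x; y]] :|: edge_nbrs v (path_edges y s).
  by apply/subsetP=> z; rewrite !inE.
apply: leq_trans (subset_leq_card sub) _; apply: leq_trans (card_setU_le _ _) _.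
have xy : x != y by apply: contraNneq xs => ->; rewrite mem_head.
have one : #|[set z | [set v; z] == [set x; y]]| <= (v == x) || (v == y).
  have [->|vx] := eqVneq v x.
    rewrite /= -(cards1 y); apply/subset_leq_card/subsetP=> z; rewrite !inE => /eqP/eq_set2.
    by case=> -[E1 E2]; apply/eqP => //; move: xy; rewrite -?E1 -?E2 eqxx.
  have [->|vy] := eqVneq v y.
    rewrite /= -(cards1 x); apply/subset_leq_card/subsetP=> z; rewrite !inE => /eqP/eq_set2.
    by case=> -[E1 E2]; apply/eqP => //; move: xy; rewrite -?E1 -?E2 eqxx.
  rewrite leqn0 cards_eq0; apply/eqP/setP=> z; rewrite !inE; apply/eqP=> /eq_set2.
  by case=> -[E _]; rewrite E eqxx in vx vy.
have := IH y us; have [vx|vx] := eqVneq v x.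
  by rewrite vx (out xs) cards0 addn0 => _; move: one; rewrite vx eqxx.
by move: one; rewrite (negbTE vx) /=; case: eqP => //= _; set a := #|_|; set b := #|_|; lia.
Qed.

End Pairs.

(** * Joining short paths into long ones *)

Section Routing.
Variables (n : nat) (adj : rel 'I_n).
Hypothesis adj_irr : irreflexive adj.

(** The bounds fit paths through at most [T] items: each item accounts for at most 6 vertices, 3 of
    its own and 3 on a link, and a union of [T] paths has degrees at most [2 * T]. *)
Definition robustly_linked (C : {set 'I_n}) (T : nat) : Prop :=
  forall (u v : 'I_n) (X : {set 'I_n}) (B : {set {set 'I_n}}),
    u \in C -> v \in C -> u != v -> #|X| <= 6 * T ->
    (forall w, #|edge_nbrs w B| <= 2 * T) ->
  exists x y z, [/\ uniq [:: u; x; y; z; v], path adj u [:: x; y; z; v],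
    all (fun w => w \notin X) [:: x; y; z] &
    [&& [set u; x] \notin B, [set x; y] \notin B, [set y; z] \notin B
      & [set z; v] \notin B]].

Variables (C : {set 'I_n}) (T : nat).
Hypotheses (T_gt0 : 0 < T) (linked : robustly_linked C T).

(* An item [p] stands for the path [p.1 - p.2 - g p], where [g] picks its exit. *)
Variable g : 'I_n * 'I_n -> 'I_n.
Implicit Types (p q : 'I_n * 'I_n) (L : seq ('I_n * 'I_n)).

Definition item_verts p := [:: p.1; p.2; g p].
Definition item_edges p : {set {set 'I_n}} := [set [set p.1; p.2]; [set p.2; g p]].
Definition is_item p :=
  [&& p.1 \in C, g p \in C, adj p.1 p.2, adj p.2 (g p) & p.1 != g p].

Lemma is_item_uniq p : is_item p -> uniq (item_verts p).
Proof.
have neq x y : adj x y -> x != y by apply: contraTneq => ->; rewrite adj_irr.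
by case/and5P=> _ _ /neq n1 /neq n2 n3; rewrite /= !inE negb_or n1 n2 n3.
Qed.

(** The path is built from its end: the tail is routed first, away from [Y] and the vertices of [p],
    and then [g p] is linked to the start of the tail. Links avoid [B], so only item edges can lie
    in [B]. *)
Lemma route_items (B : {set {set 'I_n}}) p L (Y : {set 'I_n}) :
    (forall w, #|edge_nbrs w B| <= 2 * T) ->
    uniq (p :: L) -> {in p :: L, forall q, is_item q} ->
    {in p :: L &, forall q q', q != q' -> ~~ has (mem (item_verts q)) (item_verts q')} ->
    {in p :: L, forall q, ~~ has (mem Y) (item_verts q)} ->
    6 * size (p :: L) + #|Y| <= 6 * T ->
  exists s, [/\ uniq (p.1 :: s), path adj p.1 s, ~~ has (mem Y) (p.1 :: s),
    size (p.1 :: s) <= 6 * size (p :: L) &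
    {in p :: L, forall q, item_edges q \subset path_edges p.1 s} /\
    {in path_edges p.1 s, forall e, e \in B -> exists2 q, q \in p :: L & e \in item_edges q}].
Proof.
move=> degB; elim: L p Y => [|q L IH] p Y uL itemL disjL YL szL.
  have ip := itemL p (mem_head _ _); have := ip; case/and5P=> _ _ a1 a2 _.
  exists [:: p.2; g p]; split.
  - exact: is_item_uniq.
  - by rewrite /= a1 a2.
  - exact: (YL p (mem_head _ _)).
  - by [].
  - split=> [q|e] /=; first by rewrite inE => /eqP ->; rewrite setU0.
    by rewrite setU0 => ee _; exists p; rewrite ?mem_head.
have ip := itemL p (mem_head _ _); have := ip; case/and5P=> pC gC a1 a2 _.
have up := is_item_uniq ip.
move: uL; rewrite cons_uniq => /andP[pqL uqL].
have qin : q \in p :: q :: L by rewrite !inE eqxx orbT.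
have sub r : r \in q :: L -> r \in p :: q :: L by move=> rL; rewrite inE rL orbT.
pose Y' := Y :|: [set v in item_verts p].
have cY' : #|Y'| <= #|Y| + 3.
  apply: leq_trans (card_setU_le _ _) _; rewrite leq_add2l.
  by rewrite cardsE; exact: card_size.
have [s [us ps Ys szs [sub_s B_s]]] : exists s, [/\ uniq (q.1 :: s), path adj q.1 s,
    ~~ has (mem Y') (q.1 :: s), size (q.1 :: s) <= 6 * size (q :: L) &
    {in q :: L, forall r, item_edges r \subset path_edges q.1 s} /\
    {in path_edges q.1 s, forall e, e \in B -> exists2 r, r \in q :: L & e \in item_edges r}].
  apply: IH => //.
  - by move=> r /sub; exact: itemL.
  - by move=> r r' /sub rL /sub rL'; exact: disjL.
  - move=> r rL; apply/hasPn => v vr; rewrite /= inE negb_or.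
    have /hasPn/(_ v vr) /= -> /= := YL r (sub _ rL).
    rewrite inE; have pr : p != r by apply: contraNneq pqL => ->.
    by have /hasPn/(_ v vr) := disjL _ _ (mem_head _ _) (sub _ rL) pr.
  - by move: szL cY' => /=; move: #|Y| #|Y'| (size L); clear; lia.
(* The link must avoid [Y], the 3 vertices of [p] and the tail, which has at most 6 vertices per
   remaining item; together at most [6 * T]. *)
pose X := Y' :|: [set v in q.1 :: s].
have cX : #|X| <= 6 * T.
  apply: leq_trans (card_setU_le _ _) _.
  have cs : #|[set v in q.1 :: s]| <= 6 * size (q :: L).
    by apply: leq_trans szs; rewrite cardsE; exact: card_size.
  apply: leq_trans szL; apply: leq_trans (leq_add cY' cs) _.
  by rewrite /= mulnS; move: (6 * (size L).+1) #|Y|; clear; lia.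
have Y'P v : v \in q.1 :: s -> v \notin Y' by move: Ys => /hasPn; apply.
have pY' v : v \in item_verts p -> v \in Y' by move=> vp; rewrite 2!inE vp orbT.
have gq : g p != q.1.
  have /Y'P := mem_head q.1 s; apply: contraNneq => <-.
  by apply: pY'; rewrite !inE eqxx !orbT.
have := itemL _ qin; case/and5P=> qC _ _ _ _.
have [x [y [z [uxyz pxyz Xxyz Bxyz]]]] := linked gC qC gq cX degB.
have XP v : v \in [:: x; y; z] -> v \notin Y' /\ v \notin q.1 :: s.
  move=> vin; move/allP/(_ v vin): Xxyz; rewrite /= in_setU negb_or => /andP[-> vs].
  by move: vs; rewrite inE.
exists [:: p.2, g p, x, y, z, q.1 & s]; split.
- rewrite -[_ :: _]/(item_verts p ++ ([:: x; y; z] ++ (q.1 :: s))).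
  rewrite cat_uniq cat_uniq; apply/and3P; split => //; last (apply/and3P; split=> //).
  + apply/hasPn => v; rewrite mem_cat => /orP[/XP[vY' _]|/Y'P vY'];
      by apply: contra vY'; exact: pY'.
  + move: uxyz; rewrite -[_ :: _]/([:: g p] ++ ([:: x; y; z] ++ [:: q.1])).
    by rewrite !cat_uniq => /and3P[_ _ /and3P[]].
  + by apply/hasPn => v vs; apply/negP => /XP[_]; rewrite vs.
- by move: pxyz; rewrite /= a1 a2 ps andbT /=.
- rewrite -[_ :: _]/(item_verts p ++ ([:: x; y; z] ++ (q.1 :: s))).
  have notY v : v \notin Y' -> v \notin Y by apply: contra => vY; rewrite inE vY.
  apply/hasPn => v; rewrite !mem_cat => /or3P[vp|/XP[/notY]|/Y'P/notY] //.
  by have /hasPn/(_ v vp) := YL p (mem_head _ _).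
- by move: szs => /=; clear; lia.
- split=> [r|e].
    rewrite inE => /orP[/eqP->|rL].
      by apply/subsetP => e; rewrite /= !inE => /orP[] ->; rewrite ?orbT.
    by apply: subset_trans (sub_s r rL) _; do 6!apply: (subset_trans _ (subsetUr _ _)).
  (* The edges in front of the tail are the two of the item [p] and the four of the link; the latter
     are outside [B]. *)
  case/and4P: Bxyz => B1 B2 B3 B4; rewrite /= 6!in_setU1.
  have [->|_] := eqVneq e [set p.1; p.2] => [_ _|].
    by exists p; rewrite ?mem_head // !inE eqxx.
  have [->|_] := eqVneq e [set p.2; g p] => [_ _|].
    by exists p; rewrite ?mem_head // !inE eqxx orbT.
  rewrite /= => /or4P; case=> [/eqP->|/eqP->|/eqP->|]; rewrite ?(negbTE B1) ?(negbTE B2) ?(negbTE B3) //.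
  case/orP=> [/eqP->|es]; rewrite ?(negbTE B4) // => eB.
  by have [r rL er] := B_s e es eB; exists r => //; exact: sub.
Qed.

(* Conflicting items must go to different paths: [q] conflicts with [p] also when
   [q] uses an edge of [Bf p], the set which the path through [p] has to avoid. *)
Definition conflict (Bf : 'I_n * 'I_n -> {set {set 'I_n}}) p q :=
  has (mem (item_verts p)) (item_verts q) || ~~ [disjoint item_edges q & Bf p].

(** Colour the items by [conflict] and route each class as one path, whose links avoid the union of
    [Bf p] over the class; this union has degrees at most [2 * T] because the class has at most [T]
    members. Item edges of other members avoid [Bf p] by absence of conflict. *)
Lemma path_system_avoiding (S : {set 'I_n * 'I_n}) Bf (D : nat) (x0 : 'I_n) :
    {in S, forall p, is_item p} ->
    (forall p w, p \in S -> #|edge_nbrs w (Bf p)| <= 2) ->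
    {in S, forall p, #|[set q in S | conflict Bf p q]| <= D} ->
  exists F : {set {set {set 'I_n}}}, [/\ #|F| <= (2 * D + #|S| %/ T).+1,
    forall P, P \in F -> is_path_edgeset adj P &
    {in S, forall p, exists2 P, P \in F &
      item_edges p \subset P /\ P :&: Bf p \subset item_edges p}].
Proof.
move=> itemS degBf degS.
have [col [col_ok col_small]] := exists_bounded_classes T_gt0 degS.
have /fin_all_exists[P PP] : forall k, exists P, is_path_edgeset adj P /\
    {in [set p in S | col p == k], forall p,
      item_edges p \subset P /\ P :&: Bf p \subset item_edges p}.
  move=> k; pose M := [set p in S | col p == k]; pose B := \bigcup_(p in M) Bf p.
  have MS p : p \in M -> p \in S by rewrite inE => /andP[].
  have Mk p : p \in M -> col p = k by rewrite inE => /andP[_ /eqP].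
  have degB w : #|edge_nbrs w B| <= 2 * T.
    have sub : edge_nbrs w B \subset \bigcup_(p in M) edge_nbrs w (Bf p).
      apply/subsetP => y; rewrite inE => /bigcupP[p pM yp].
      by apply/bigcupP; exists p => //; rewrite inE.
    apply: leq_trans (subset_leq_card sub) _; apply: (@leq_trans (2 * #|M|)).
      by apply: card_bigcup_le => p /MS pS; exact: degBf.
    by rewrite leq_mul2l col_small.
  case EM : (enum M) => [|p L].
    (* An empty class gets the path without edges at [x0]. *)
    exists set0; split; first by exists x0, [::].
    by move=> p; rewrite -/M -mem_enum EM.
  have inM q : (q \in p :: L) = (q \in M) by rewrite -EM mem_enum.
  have sM : size (p :: L) <= T by rewrite -EM -cardE col_small.
  have confM q q' : q \in M -> q' \in M -> q != q' -> ~~ conflict Bf q q'.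
    by move=> qM q'M; apply: col_ok; rewrite ?MS // (Mk _ qM) (Mk _ q'M).
  have [||||||s [us ps _ _ [sub_s B_s]]] := @route_items B p L set0.
  - exact: degB.
  - by rewrite -EM enum_uniq.
  - by move=> q; rewrite inM => /MS/itemS.
  - move=> q q'; rewrite !inM => qM q'M qq'.
    by have := confM _ _ qM q'M qq'; rewrite negb_or => /andP[].
  - by move=> q _; apply/hasPn => v _ /=; rewrite inE.
  - by rewrite cards0 addn0 leq_mul2l.
  exists (path_edges p.1 s); split; first by exists p.1, s.
  move=> q; rewrite -/M => qM; split; first by apply: sub_s; rewrite inM.
  apply/subsetP => e; rewrite inE => /andP[es eq].
  (* An edge of the path in [Bf q] belongs to some item [r] of the class, and [r != q] would be a
     conflict. *)
  have [|r] := B_s e es; first by apply/bigcupP; exists q.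
  rewrite inM => rM er; have [<- //|qr] := eqVneq r q.
  rewrite eq_sym in qr; have := confM _ _ qM rM qr; rewrite negb_or negbK => /andP[_].
  by move/disjointFr/(_ er); rewrite eq.
exists [set P k | k in 'I_(2 * D + #|S| %/ T).+1]; split.
- by apply: leq_trans (leq_imset_card _ _) _; rewrite card_ord.
- by move=> _ /imsetP[k _ ->]; have [] := PP k.
- move=> p pS; exists (P (col p)); first by apply: imset_f.
  by have [_] := PP (col p); apply; rewrite inE pS eqxx.
Qed.

(** Once the position of [v] among the three vertices is fixed, one further vertex of [U] determines
    the item: the middle one if [v] is the start or the exit, the start if [v] is the middle. *)
Lemma card_item_verts_le (S : {set 'I_n * 'I_n}) (U : {set 'I_n}) v :
    {in S, forall p, (p.1 \in U) && (p.2 \in U)} ->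
    {in S &, forall p q, p.2 = q.2 -> g p = g q -> p.1 = q.1} ->
  #|[set q in S | v \in item_verts q]| <= 3 * #|U|.
Proof.
move=> SU g_inj.
pose A i := [set q in S | nth v (item_verts q) i == v].
have leA : [set q in S | v \in item_verts q] \subset A 0 :|: A 1 :|: A 2.
  apply/subsetP => q; rewrite !inE /= => /andP[-> /=].
  by rewrite ![v == _]eq_sym -orbA.
have inj_le (h : 'I_n * 'I_n -> 'I_n) i : {in A i &, injective h} ->
    {in A i, forall p, h p \in U} -> #|A i| <= #|U|.
  move=> h_inj hU; rewrite -(card_in_imset h_inj) subset_leq_card //.
  by apply/subsetP => _ /imsetP[p pA ->]; exact: hU.
have A0 : #|A 0| <= #|U|.
  apply: (inj_le snd) => [p q|p]; rewrite !inE /=; last by case/andP=> /SU/andP[].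
  by case: p q => [a b] [a' b'] /andP[_ /eqP/= ->] /andP[_ /eqP/= ->] ->.
have A1 : #|A 1| <= #|U|.
  apply: (inj_le fst) => [p q|p]; rewrite !inE /=; last by case/andP=> /SU/andP[].
  by case: p q => [a b] [a' b'] /andP[_ /eqP/= ->] /andP[_ /eqP/= ->] ->.
have A2 : #|A 2| <= #|U|.
  apply: (inj_le snd) => [p q|p]; rewrite !inE /=; last by case/andP=> /SU/andP[].
  move=> /andP[pS /eqP gp] /andP[qS /eqP gq] pq.
  have := g_inj _ _ pS qS pq; rewrite gp gq => /(_ erefl).
  by case: p q pq {pS qS gp gq} => [a b] [a' b'] /= -> ->.
apply: leq_trans (subset_leq_card leA) _.
apply: leq_trans (card_setU_le _ _) _; have := card_setU_le (A 0) (A 1).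
move: A0 A1 A2; move: #|A 0| #|A 1| #|A 2| #|A 0 :|: A 1| #|U|; clear; lia.
Qed.

(** The constant is 13 = 3 * 3 + 2 + 2: items through one of the three vertices of [p], and items
    whose first or second edge lies in [Bf p]. *)
Lemma card_conflict_le (S : {set 'I_n * 'I_n}) (U : {set 'I_n}) Bf p :
    {in S, forall p, (p.1 \in U) && (p.2 \in U)} ->
    {in S &, forall p q, p.2 = q.2 -> g p = g q -> p.1 = q.1} ->
    (forall w, #|edge_nbrs w (Bf p)| <= 2) ->
  #|[set q in S | conflict Bf p q]| <= 13 * #|U|.
Proof.
move=> SU g_inj degBf.
pose V v := [set q in S | v \in item_verts q].
have VU v : #|V v| <= 3 * #|U| by exact: card_item_verts_le.
(* Oriented edges of [Bf p] that start in [U]. Items in [E1] and in [E2] are both determined by such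
   an oriented edge. *)
pose W := [set q : 'I_n * 'I_n | (q.1 \in U) && ([set q.1; q.2] \in Bf p)].
have WU : #|W| <= 2 * #|U|.
  have sub : W \subset \bigcup_(u in U) [set (u, w) | w in edge_nbrs u (Bf p)].
    apply/subsetP => -[u w]; rewrite inE /= => /andP[uU uw].
    by apply/bigcupP; exists u => //; apply/imsetP; exists w; rewrite ?inE.
  apply: leq_trans (subset_leq_card sub) _; apply: card_bigcup_le => u _.
  by apply: leq_trans (leq_imset_card _ _) _.
pose E1 := [set q in S | [set q.1; q.2] \in Bf p].
pose E2 := [set q in S | [set q.2; g q] \in Bf p].
have E1U : #|E1| <= 2 * #|U|.
  apply: leq_trans WU; apply/subset_leq_card/subsetP => q.
  by rewrite !inE => /andP[/SU/andP[-> _] ->].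
have E2U : #|E2| <= 2 * #|U|.
  have f_inj : {in E2 &, injective (fun q => (q.2, g q))}.
    move=> q q'; rewrite !inE => /andP[qS _] /andP[q'S _] [e2 eg].
    have := g_inj _ _ qS q'S e2 eg.
    by case: q q' e2 {qS q'S eg} => [a b] [a' b'] /= -> ->.
  rewrite -(card_in_imset f_inj); apply: leq_trans WU.
  apply/subset_leq_card/subsetP => u /imsetP[q qE ->].
  by move: qE; rewrite !inE /= => /andP[/SU/andP[_ ->] ->].
have sub : [set q in S | conflict Bf p q] \subset
    V p.1 :|: V p.2 :|: V (g p) :|: (E1 :|: E2).
  apply/subsetP => q; rewrite inE => /andP[qS /orP[/hasP[v vq vp]|]].
    have vV : q \in V v by rewrite inE qS.
    have {}vp : [|| v == p.1, v == p.2 | v == g p] by move: vp; rewrite !inE.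
    by case/or3P: vp vV => /eqP-> vV; rewrite !in_setU vV ?orbT.
  case/pred0Pn => e /andP[/=]; rewrite !in_setU !inE qS /=.
  by case/orP=> /eqP-> ->; rewrite ?orbT.
apply: leq_trans (subset_leq_card sub) _.
have := card_setU_le (V p.1 :|: V p.2 :|: V (g p)) (E1 :|: E2).
have := card_setU_le (V p.1 :|: V p.2) (V (g p)).
have := card_setU_le (V p.1) (V p.2); have := card_setU_le E1 E2.
have := VU p.1; have := VU p.2; have := VU (g p); move: E1U E2U.
move: #|_| #|_| #|_| #|_| #|_| #|_| #|_| #|_| #|_| #|_|; clear; lia.
Qed.

End Routing.

(** * Isolating all edges that meet a linked set *)

Lemma is_path_edgeset1 (n : nat) (adj : rel 'I_n) x y :
  irreflexive adj -> adj x y -> is_path_edgeset adj [set [set x; y]].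
Proof.
move=> adj_irr xy; exists x, [:: y]; split.
- by rewrite /= inE andbT; apply: contraTneq xy => ->; rewrite adj_irr.
- by rewrite /= xy.
- by rewrite /= setU0.
Qed.

Lemma next_prev_neq (T : eqType) (s : seq T) a :
    uniq s -> a \in s -> 2 < size s ->
  [/\ next s a != a, prev s a != a & next s a != prev s a].
Proof.
move=> us sa s3; have [i s' Es] := rot_to sa.
rewrite -(next_rot i us) -(prev_rot i us) Es.
have : uniq (a :: s') by rewrite -Es rot_uniq.
have : 2 < size (a :: s') by rewrite -Es size_rot.
case: s' {Es} => [|y [|z s']] // _; rewrite /= eqxx !inE !negb_or.
case/and3P=> /and3P[ay az as'] /andP[yz ys'] /andP[zs' us'].
rewrite (negbTE ay) (negbTE az); have ya : y != a by rewrite eq_sym.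
  (* After the rotation [a] comes first, so its cyclic predecessor is the last entry, while its
     successor is [y]. *)
  have last_in : prev_at a a z s' = last z s'.
    elim: s' z as' {az zs' ys' us' yz} => [|w s' IH] z; first by rewrite /= eqxx.
    by rewrite inE negb_or => /andP[/negbTE aw as']; rewrite /= aw IH.
  have := mem_last z s'; rewrite -last_in => lin; split=> //.
    by apply: contraTneq lin => ->; rewrite inE negb_or az.
  by apply: contraTneq lin => <-; rewrite inE negb_or yz.
Qed.

(** [P] and [Q] may coincide, so a path with the single edge [e] isolates [e]. *)
Definition isolates (n : nat) (F : {set {set {set 'I_n}}}) (e : {set 'I_n}) : Prop :=
  exists P Q, [/\ P \in F, Q \in F & P :&: Q = [set e]].

Lemma card_edge_nbrs_le2 (n : nat) (adj : rel 'I_n) P v :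
  is_path_edgeset adj P -> #|edge_nbrs v P| <= 2.
Proof.
by case=> x [s [us _ ->]]; apply: leq_trans (card_edge_nbrs_path v us) (leq_subr _ _).
Qed.

Section Stage.
Variables (n : nat) (adj : rel 'I_n).
Hypotheses (adj_sym : symmetric adj) (adj_irr : irreflexive adj).

(** Each of the two path systems costs [26 * #|U| + #|C| * #|U| %/ T + 1], by the conflict bound
    [13 * #|U|]; the edges at vertices with at most two neighbours in [C] add [2 * #|U|]. *)
Lemma isolate_edges_at (U C : {set 'I_n}) (T : nat) :
    C \subset U -> C != set0 -> 0 < T -> robustly_linked adj C T ->
  exists F : {set {set {set 'I_n}}},
    [/\ #|F| <= 54 * #|U| + 2 * (#|C| * #|U| %/ T) + 2,
        forall P, P \in F -> is_path_edgeset adj P &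
        forall a b, a \in C -> b \in U -> adj a b -> isolates F [set a; b]].
Proof.
move=> /subsetP CU /set0Pn[x0 x0C] T_gt0 linked.
pose N b := enum [set a in C | adj a b].
have uN b : uniq (N b) by exact: enum_uniq.
have mN a b : (a \in N b) = (a \in C) && adj a b by rewrite mem_enum inE.
(* Oriented edges to be prolonged. Three neighbours of [p.2] in [C] are required so that successor
   and predecessor differ from each other and from [p.1]. *)
pose S := [set p : 'I_n * 'I_n | [&& p.1 \in C, p.2 \in U, adj p.1 p.2 & 2 < size (N p.2)]].
pose gA p := next (N p.2) p.1; pose gB p := prev (N p.2) p.1.
have SN p : p \in S -> p.1 \in N p.2 by rewrite inE mN => /and4P[-> _ ->].
have SU : {in S, forall p, (p.1 \in U) && (p.2 \in U)}.
  by move=> p; rewrite inE => /and4P[/CU -> ->].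
have cS : #|S| <= #|C| * #|U|.
  rewrite -cardsX; apply/subset_leq_card/subsetP => p; rewrite !inE.
  by case/and4P=> -> ->.
have neqS p : p \in S -> [/\ gA p != p.1, gB p != p.1 & gA p != gB p].
  by move=> pS; apply: next_prev_neq; rewrite ?SN //; move: pS; rewrite inE => /and4P[].
have itemA : {in S, forall p, is_item adj C gA p}.
  move=> p pS; have [nA _ _] := neqS p pS; move: (SN p pS) => pN.
  have := mem_next (N p.2) p.1; rewrite pN => gN; move: pN gN; rewrite -/(gA p) !mN.
  by case/andP=> c1 a1 /andP[c2 a2]; rewrite /is_item c1 c2 a1 adj_sym a2 eq_sym nA.
have itemB : {in S, forall p, is_item adj C gB p}.
  move=> p pS; have [_ nB _] := neqS p pS; move: (SN p pS) => pN.
  have := mem_prev (N p.2) p.1; rewrite pN => gN; move: pN gN; rewrite -/(gB p) !mN.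
  by case/andP=> c1 a1 /andP[c2 a2]; rewrite /is_item c1 c2 a1 adj_sym a2 eq_sym nB.
have injA : {in S &, forall p q, p.2 = q.2 -> gA p = gA q -> p.1 = q.1}.
  by move=> p q _ _ pq; rewrite /gA pq; apply: (can_inj (prev_next (uN _))).
have injB : {in S &, forall p q, p.2 = q.2 -> gB p = gB q -> p.1 = q.1}.
  by move=> p q _ _ pq; rewrite /gB pq; apply: (can_inj (next_prev (uN _))).
have deg0 w : #|edge_nbrs w (set0 : {set {set 'I_n}})| <= 2.
  by rewrite (_ : edge_nbrs _ _ = set0) ?cards0 //; apply/setP => y; rewrite !inE.
have [|||FA [cA pathA coverA]] := @path_system_avoiding _ adj adj_irr C T T_gt0 linked gA
    S (fun=> set0) (13 * #|U|) x0 => //.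
  by move=> p _; apply: card_conflict_le.
(* The path through each item is made a total function of the item, with [set0] as a dummy value
   outside [S]; it then serves as the avoided set of the second system. *)
have PA_ex p : exists P, p \in S -> P \in FA /\ item_edges gA p \subset P.
  case: (boolP (p \in S)) => [/coverA[P PF [sub _]]|_]; last by exists set0.
  by exists P.
have /fin_all_exists[PA PAP] := PA_ex.
have degPA p w : p \in S -> #|edge_nbrs w (PA p)| <= 2.
  by case/PAP => /pathA + _; exact: card_edge_nbrs_le2.
have [|||FB [cB pathB coverB]] := @path_system_avoiding _ adj adj_irr C T T_gt0 linked gB
    S PA (13 * #|U|) x0 => //.
  by move=> p pS; apply: card_conflict_le => // w; exact: degPA.
pose thin := [set p : 'I_n * 'I_n | [&& p.1 \in C, p.2 \in U, adj p.1 p.2 & size (N p.2) <= 2]].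
pose F1 := [set [set [set p.1; p.2]] | p in thin].
have c1 : #|F1| <= 2 * #|U|.
  apply: leq_trans (leq_imset_card _ _) _.
  have sub : thin \subset \bigcup_(b in [set b in U | size (N b) <= 2])
      [set (a, b) | a in [set a in C | adj a b]].
    apply/subsetP => -[a b]; rewrite inE /= => /and4P[aC bU ab b2].
    apply/bigcupP; exists b; first by rewrite inE bU.
    by apply/imsetP; exists a => //; rewrite inE aC.
  apply: leq_trans (subset_leq_card sub) _.
  apply: (@leq_trans (2 * #|[set b in U | size (N b) <= 2]|)).
    apply: card_bigcup_le => b; rewrite inE => /andP[_ b2].
    by apply: leq_trans (leq_imset_card _ _) _; rewrite cardE.
  by rewrite leq_mul2l /=; apply/subset_leq_card/subsetP => b; rewrite inE => /andP[].
exists (FA :|: FB :|: F1); split.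
- apply: leq_trans (card_setU_le _ _) _.
  have := card_setU_le FA FB.
  have : #|S| %/ T <= #|C| * #|U| %/ T by exact: leq_div2r.
  move: c1 cA cB; move: #|FA| #|FB| #|F1| #|_ :|: _| (#|S| %/ T) (_ %/ T) #|U|.
  clear; lia.
- move=> P; rewrite !in_setU -orbA => /or3P[/pathA|/pathB|/imsetP[p]] //.
  by rewrite inE => /and4P[_ _ pp _ ->]; exact: is_path_edgeset1.
- move=> a b aC bU ab; have [b2|b3] := leqP (size (N b)) 2.
    have inF1 : [set [set a; b]] \in F1.
      by apply/imsetP; exists (a, b); rewrite // inE /= aC bU ab.
    by exists [set [set a; b]], [set [set a; b]]; rewrite setIid !in_setU inF1 !orbT.
  have pS : (a, b) \in S by rewrite inE /= aC bU ab.
  have [PF subA] := PAP _ pS; have [Q QF [subB capB]] := coverB _ pS.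
  exists (PA (a, b)), Q; split; rewrite ?in_setU ?PF ?QF ?orbT //.
  apply/eqP; rewrite eqEsubset; apply/andP; split; last first.
    by rewrite sub1set inE (subsetP subA) ?(subsetP subB) // !inE eqxx.
  apply/subsetP => e; rewrite setIC => eQ; have := subsetP capB _ eQ.
  rewrite !inE => /orP[//|/eqP eE]; case: notF.
  have [/= nA nB nAB] := neqS _ pS.
  (* If the first path also contained the edge from [b] to [gB (a, b)], it would have three edges at
     [b]. *)
  suff : 2 < #|edge_nbrs b (PA (a, b))| by rewrite ltnNge degPA.
  apply: (@leq_trans #|[set a; gA (a, b); gB (a, b)]|).
    by rewrite setUC cardsU1 cards2 !inE negb_or nB (eq_sym (gB _)) nAB (eq_sym a) nA.
  apply/subset_leq_card/subsetP => y; rewrite !inE -orbA => /or3P[] /eqP->.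
  + by rewrite setUC (subsetP subA) // !inE eqxx.
  + by rewrite (subsetP subA) // !inE eqxx orbT.
  + by move: eQ; rewrite eE inE => /andP[].
Qed.
End Stage.

(** * Dependent random choice in a dense set *)

Lemma exists_notin (I : finType) (A B : {set I}) :
  #|A| < #|B| -> exists2 x, x \in B & x \notin A.
Proof.
by move=> lt; apply/subsetPn; apply: contraL lt => /subset_leq_card; rewrite -leqNgt.
Qed.

Section Density.
Variables (n : nat) (adj : rel 'I_n).
Hypotheses (adj_sym : symmetric adj) (adj_irr : irreflexive adj).
Variable U : {set 'I_n}.

Definition nbrs w := [set u in U | adj w u].

Lemma spanned_edges_le : spanned_edges adj U <= \sum_(w in U) #|nbrs w|.
Proof.
apply: (@leq_trans #|\bigcup_(w in U) [set [set w; u] | u in nbrs w]|).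
  apply/subset_leq_card/subsetP => e; rewrite !inE => /andP[/existsP[x /existsP[y]]].
  case/andP=> xy /eqP -> /subsetP sub; apply/bigcupP; exists x.
    by rewrite sub ?set21.
  by apply/imsetP; exists y => //; rewrite inE xy sub ?set22.
apply: leq_trans (card_bigcup_le_sum _ _) _.
by apply: leq_sum => w _; exact: leq_imset_card.
Qed.

Lemma spanned_edges_le_sqr : spanned_edges adj U <= #|U| ^ 2.
Proof.
apply: leq_trans spanned_edges_le _; rewrite expnS expn1 -sum_nat_const.
apply: leq_sum => w _; apply/subset_leq_card/subsetP => u.
by rewrite inE => /andP[].
Qed.

Section BadPairs.
Variable bad : rel 'I_n.

Definition bad_pairs w :=
  [set p | [&& p.1 \in nbrs w, p.2 \in nbrs w & bad p.1 p.2]].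
Definition bad_partners w u := [set v in nbrs w | bad u v].

(** Double counting of a vertex of [U] together with an ordered bad pair in its neighbourhood. *)
Lemma sum_bad_pairs :
  \sum_(w in U) #|bad_pairs w| =
  \sum_(p in setX U U | bad p.1 p.2) #|nbrs p.1 :&: nbrs p.2|.
Proof.
under eq_bigr do rewrite -sum1dep_card.
rewrite (exchange_big_dep (fun p => (p \in setX U U) && bad p.1 p.2)) /=; last first.
  by move=> w p _; rewrite !inE => /and3P[/andP[-> _] /andP[-> _] ->].
apply: eq_bigr => p; rewrite inE => /andP[/andP[p1 p2] bp].
rewrite sum1dep_card; apply: eq_card => w; rewrite !inE p1 p2 bp !andbT /=.
by rewrite !(adj_sym w); case: (w \in U).
Qed.

Lemma card_bad_pairs w : #|bad_pairs w| = \sum_(u in nbrs w) #|bad_partners w u|.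
Proof.
under [RHS]eq_bigr do rewrite -sum1dep_card.
rewrite pair_big_dep /= -sum1_card; apply: eq_bigl => p.
by rewrite [LHS]inE inE.
Qed.

(** With the fraction 2/5, two typical vertices together rule out at most 4/5 of [nbrs w], which
    leaves a fifth for the middle vertex of a link. *)
Definition typical w := [set u in nbrs w | 5 * #|bad_partners w u| <= 2 * #|nbrs w|].

(** Markov's inequality: every atypical vertex of [nbrs w] lies in more than [2 * #|nbrs w| / 5] of
    the at most [#|nbrs w| ^ 2 / 5] bad pairs, so at most half of [nbrs w] is atypical. *)
Lemma card_typical w : 0 < #|nbrs w| ->
  5 * #|bad_pairs w| <= #|nbrs w| ^ 2 -> #|nbrs w| <= 2 * #|typical w|.
Proof.
move=> N0 few; have sub : typical w \subset nbrs w.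
  by apply/subsetP => u; rewrite inE => /andP[].
have := cardsID (typical w) (nbrs w); rewrite (setIidPr sub) => cN.
have : 2 * #|nbrs w| * #|nbrs w :\: typical w| <= #|nbrs w| ^ 2.
  apply: leq_trans few; rewrite card_bad_pairs mulnC -sum_nat_const big_distrr /=.
  rewrite [leqRHS](big_setID (nbrs w :\: typical w)) /=.
  rewrite (setIidPr (subsetDl _ _)); apply: leq_trans (leq_addr _ _).
  apply: leq_sum => u; rewrite 2!inE => /andP[+ uN]; rewrite uN /= -ltnNge.
  exact: ltnW.
rewrite expnS expn1 mulnAC leq_pmul2r // -cN.
by move: #|typical w| #|nbrs w :\: typical w|; clear; lia.
Qed.

(** Choose the middle vertex [y] in [nbrs w] so that it forms no bad pair with [u] or [v], then [x]
    among the common neighbours of [u] and [y], and [z] among those of [v] and [y]. *)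
Lemma typical_linked (w : 'I_n) (T : nat) :
    5 * (6 * T + 2) < #|nbrs w| ->
    (forall u v, ~~ bad u v -> 10 * T + 2 < #|nbrs u :&: nbrs v|) ->
  robustly_linked adj (typical w) T.
Proof.
move=> largeN good u v X B; rewrite !inE => /andP[uN ub] /andP[vN vb] uv cX degB.
have [y yN] : exists2 y, y \in nbrs w &
    y \notin bad_partners w u :|: bad_partners w v :|: X :|: [set u; v].
  apply: exists_notin.
  have := card_setU_le (bad_partners w u :|: bad_partners w v :|: X) [set u; v].
  have := card_setU_le (bad_partners w u :|: bad_partners w v) X.
  have := card_setU_le (bad_partners w u) (bad_partners w v).
  rewrite cards2 uv; move: cX ub vb largeN.
  by move: #|_| #|_| #|_| #|_| #|_| #|_| #|_|; clear; lia.
rewrite !in_setU !negb_or => /andP[/andP[/andP[yu yv] yX] /andP[]].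
rewrite !in_set1 => yNu yNv.
have {}yu : ~~ bad u y by move: yu; rewrite inE yN.
have {}yv : ~~ bad v y by move: yv; rewrite inE yN.
(* The excluded vertices number at most 6T for [X], 2T for each of the two ends because of [B], and
   2 for distinctness: in all 10T + 2. *)
have pick a (b b' : 'I_n) : ~~ bad a y -> exists2 x, x \in nbrs a :&: nbrs y &
    x \notin X :|: edge_nbrs a B :|: edge_nbrs y B :|: [set b; b'].
  move=> /good lt; apply: exists_notin; apply: leq_ltn_trans lt.
  have := card_setU_le (X :|: edge_nbrs a B :|: edge_nbrs y B) [set b; b'].
  have := card_setU_le (X :|: edge_nbrs a B) (edge_nbrs y B).
  have := card_setU_le X (edge_nbrs a B); have := degB a; have := degB y.
  have : #|[set b; b']| <= 2 by rewrite cards2; case: (_ != _).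
  move: cX.
  by move: #|_| #|_| #|_| #|_| #|_| #|_| #|_|; clear; lia.
have neq a b : adj a b -> a != b by apply: contraTneq => ->; rewrite adj_irr.
have [x] := pick u v v yu; rewrite !inE => /andP[/andP[xU ux] /andP[_ yx]].
rewrite !negb_or -!andbA => /and5P[xX xB1 xB2 xv _].
have [z] := pick v u x yv; rewrite !inE => /andP[/andP[zU vz] /andP[_ yz]].
rewrite !negb_or -!andbA => /and5P[zX zB1 zB2 zu zx].
exists x, y, z; split.
- rewrite /= !inE !negb_or uv (neq _ _ ux) (eq_sym u y) yNu (eq_sym u z) zu.
  by rewrite (eq_sym x y) (neq _ _ yx) (eq_sym x z) zx xv (neq _ _ yz) yNv (eq_sym z v) (neq _ _ vz).
- by rewrite /= ux (adj_sym x) yx yz (adj_sym z) vz.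
- by rewrite /= xX yX zX.
- by rewrite xB1 (setUC [set x]) xB2 zB2 (setUC [set z]) zB1.
Qed.

End BadPairs.
End Density.

(** * Choice of parameters and iteration *)

Local Open Scope ring_scope.

Section Main.
Variables (R : realType) (n : nat) (adj : rel 'I_n).
Hypotheses (adj_sym : symmetric adj) (adj_irr : irreflexive adj).

(** Averaging over [w] yields a neighbourhood that is large and has few bad pairs at once; its
    typical vertices form [C]. A pair is bad if it has fewer than [c ^+ 2 / 10 * #|U|] common
    neighbours in [U]. *)
Lemma exists_linked_set (c : R) (U : {set 'I_n}) (T : nat) :
    0 < c -> (0 < #|U|)%N ->
    c * (#|U|%:R) ^+ 2 <= (spanned_edges adj U)%:R ->
    (10 * T + 2)%:R < c ^+ 2 / 10 * #|U|%:R ->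
    (6 * T + 2)%:R < c * #|U|%:R / 10 ->
  exists C : {set 'I_n}, [/\ C \subset U, c * #|U|%:R / 4 <= #|C|%:R &
    robustly_linked adj C T].
Proof.
move=> c0 U0 dense T10 T6; set m : R := #|U|%:R in dense T10 T6 *.
have m0 : 0 < m by rewrite ltr0n.
pose bad := [rel u v | #|nbrs adj U u :&: nbrs adj U v|%:R < c ^+ 2 / 10 * m].
pose d w : R := #|nbrs adj U w|%:R.
pose b w : R := #|bad_pairs adj U bad w|%:R.
have sum_d : c * m ^+ 2 <= \sum_(w in U) d w.
  apply: le_trans dense _; rewrite /d -natr_sum ler_nat.
  exact: spanned_edges_le.
have sum_b : \sum_(w in U) b w <= c ^+ 2 / 10 * m * m ^+ 2.
  rewrite /b -natr_sum sum_bad_pairs // natr_sum.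
  apply: (@le_trans _ _ (\sum_(p in setX U U) (c ^+ 2 / 10 * m))).
    rewrite big_mkcondr /=; apply: ler_sum => p _; case: ifP => [/ltW//|_].
    by rewrite mulr_ge0 ?(ltW m0) // divr_ge0 ?ler0n ?sqr_ge0.
  by rewrite sumr_const cardsX -[leLHS]mulr_natr natrM.
have [w wU few] : exists2 w, w \in U & c ^+ 2 * m ^+ 2 / 10 <= d w ^+ 2 / 5 - b w.
  apply/exists_inP; apply: contraT; rewrite negb_exists_in => /forall_inP no_w.
  (* The square of [d w] is bounded below by its tangent at [c * m]. Summation gives at least
     [c ^+ 2 * m ^+ 3 / 5] minus the bad pairs, which number at most [c ^+ 2 * m ^+ 3 / 10]. *)
  have lower : \sum_(w in U) ((2 * c * m * d w - c ^+ 2 * m ^+ 2) / 5 - b w)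
      <= \sum_(w in U) (d w ^+ 2 / 5 - b w).
    apply: ler_sum => w _; have := sqr_ge0 (d w - c * m); rewrite sqrrB exprMn; nra.
  have upper : \sum_(w in U) (d w ^+ 2 / 5 - b w) < \sum_(w in U) (c ^+ 2 * m ^+ 2 / 10).
    have [w0 w0U] : exists w, w \in U by apply/card_gt0P.
    rewrite (bigD1 w0) // [ltRHS](bigD1 w0) //= ltr_leD //.
      by rewrite ltNge no_w.
    by apply: ler_sum => w /andP[wU _]; rewrite ltW // ltNge no_w.
  have sum_lower : \sum_(w in U) ((2 * c * m * d w - c ^+ 2 * m ^+ 2) / 5 - b w) =
      (2 * c * m * (\sum_(w in U) d w) - c ^+ 2 * m ^+ 2 * m) / 5 - \sum_(w in U) b w.
    rewrite sumrB; congr (_ - _); rewrite -mulr_suml; congr (_ / _).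
    by rewrite sumrB -mulr_sumr sumr_const -[X in _ - X]mulr_natr.
  have := le_lt_trans lower upper; rewrite sum_lower sumr_const -[ltRHS]mulr_natr -/m => lt.
  have := ler_wpM2l (ltW (mulr_gt0 c0 m0)) sum_d.
  suff : ~ (c * m * (c * m ^+ 2) <= c * m * \sum_(w in U) d w) by [].
  by move: lt sum_b; move: (\sum_(w in U) d w) (\sum_(w in U) b w) => sd sb; nra.
have b0 : 0 <= b w by rewrite ler0n.
have d0 : 0 <= d w by rewrite ler0n.
have d_large : c * m / 2 <= d w.
  rewrite leNgt; apply/negP => lt; have cm0 : 0 < c * m by rewrite mulr_gt0.
  nra.
have cm0 : 0 < c * m by rewrite mulr_gt0.
exists (typical adj U bad w); split.
- by apply/subsetP => u; rewrite !inE => /andP[/andP[]].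
- have : (#|nbrs adj U w| <= 2 * #|typical adj U bad w|)%N.
    apply: card_typical; first by rewrite -(ltr0n R) -/(d w); lra.
    rewrite -(ler_nat R) natrM natrX -/(b w) -/(d w).
    have : 0 <= c ^+ 2 * m ^+ 2 by rewrite mulr_ge0 ?sqr_ge0.
    lra.
  by rewrite -(ler_nat R) natrM -/(d w) => ?; lra.
- apply: typical_linked => //.
    rewrite -(ltr_nat R) natrM -/(d w); lra.
  by move=> u v; rewrite /bad /= -leNgt -(ltr_nat R); apply: lt_le_trans.
Qed.

Lemma isolates_sub (F F' : {set {set {set 'I_n}}}) e :
  F \subset F' -> isolates F e -> isolates F' e.
Proof.
by move=> /subsetP sub [P [Q [PF QF PQ]]]; exists P, Q; split; rewrite ?sub.
Qed.

(** Since [c ^+ 2 * m >= 640], rounding down costs little: [T >= c ^+ 2 * m / 160]. With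
    [m <= 4 * k / c] the terms [54 * m], [2 * q] and [2 <= 2 * m] contribute 216, 320 and 8 to the
    constant 544. *)
Lemma isolate_linked_part (c : R) (U : {set 'I_n}) :
    0 < c -> c <= 1 -> 640 <= c ^+ 2 * #|U|%:R ->
    c * (#|U|%:R) ^+ 2 <= (spanned_edges adj U)%:R ->
  exists (C : {set 'I_n}) (F : {set {set {set 'I_n}}}),
    [/\ C \subset U, C != set0, #|F|%:R <= 544 / c ^+ 3 * #|C|%:R,
        forall P, P \in F -> is_path_edgeset adj P &
        forall a b, a \in C -> b \in U -> adj a b -> isolates F [set a; b]].
Proof.
move=> c0 c1 large dense.
pose T := Num.truncn (c ^+ 2 * #|U|%:R / 128).
have : 0 <= c ^+ 2 * #|U|%:R / 128 by lra.
move/truncn_itv/andP; rewrite -/T -[T.+1%:R]natr1 => -[T1 T2].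
set m : R := #|U|%:R in large dense T1 T2.
have m0 : 0 < m by have := sqr_ge0 c; rewrite ltNge; apply: contraTN => ?; nra.
have U0 : (0 < #|U|)%N by rewrite -(ltr0n R).
have T0 : (0 < T)%N by rewrite -(ltr0n R); lra.
have ccm : c ^+ 2 * m <= c * m by rewrite ler_pM2r // expr2 ger_pMr.
have [||C [CU cC linked]] := exists_linked_set (T := T) c0 U0 dense.
- by rewrite natrD natrM -/m; lra.
- by rewrite natrD natrM -/m; lra.
have C0 : C != set0.
  rewrite -card_gt0 -(ltr0n R); apply: lt_le_trans cC.
  by rewrite divr_gt0 ?mulr_gt0 ?ltr0n.
have [F [cF pathF isoF]] := isolate_edges_at adj_sym adj_irr CU C0 T0 linked.
exists C, F; split=> //.
set k : R := #|C|%:R in cC *; set q := (#|C| * #|U| %/ T)%N in cF.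
have qT : q%:R * T%:R <= k * m by rewrite -!natrM ler_nat leq_divM.
pose v := c^-1; have cv : c * v = 1 by rewrite mulfV ?gt_eqF.
have v1 : 1 <= v by rewrite invr_ge1 ?unitfE ?gt_eqF // inE.
have k0 : 0 <= k by rewrite ler0n.
have mk : m <= 4 * v * k.
  have : v * (c * m / 4) <= v * k by rewrite ler_wpM2l //; lra.
  by rewrite !mulrA (mulrC v) cv; lra.
have q0 : 0 <= q%:R :> R by rewrite ler0n.
have qk : q%:R <= 160 * v ^+ 2 * k.
  have : q%:R * (c ^+ 2 * m / 160) <= k * m.
    by apply: le_trans qT; rewrite ler_wpM2l //; lra.
  have -> : q%:R * (c ^+ 2 * m / 160) = (q%:R * (c ^+ 2 / 160)) * m by ring.
  rewrite ler_pM2r // => h.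
  have : v ^+ 2 * (q%:R * (c ^+ 2 / 160)) <= v ^+ 2 * k by rewrite ler_wpM2l ?sqr_ge0.
  have -> : v ^+ 2 * (q%:R * (c ^+ 2 / 160)) = (c * v) ^+ 2 * (q%:R / 160) by ring.
  by rewrite cv expr1n; lra.
have : #|F|%:R <= 54 * m + 2 * q%:R + 2 :> R.
  have -> : 54 * m + 2 * q%:R + 2 = (54 * #|U| + 2 * q + 2)%N%:R.
    by rewrite natrD natrD natrM natrM.
  by rewrite ler_nat.
have m1 : 1 <= m by rewrite ler1n.
have -> : 544 / c ^+ 3 = 544 * v ^+ 3 by rewrite exprVn.
have v12 : v * k <= v ^+ 3 * k by rewrite ler_wpM2r // ler_eXnr.
have v23 : v ^+ 2 * k <= v ^+ 3 * k by rewrite ler_wpM2r // ler_weXn2l.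
lra.
Qed.

(** Splitting off [C] costs an amount proportional to [#|C|], so the costs of all rounds add up to a
    multiple of [#|U|]. The summand [n%:R] pays once for the edges left at the end. *)
Lemma isolate_edges_in (c : R) (U : {set 'I_n}) :
    0 < c -> c <= 1 -> 640 / c ^+ 2 <= Num.sqrt n%:R ->
    (forall U : {set 'I_n}, Num.sqrt (n%:R : R) <= (#|U|%:R : R) ->
       c * (#|U|%:R) ^+ 2 <= (spanned_edges adj U)%:R) ->
  exists F : {set {set {set 'I_n}}},
    [/\ #|F|%:R <= 544 / c ^+ 3 * #|U|%:R + n%:R,
        forall P, P \in F -> is_path_edgeset adj P &
        forall a b, a \in U -> b \in U -> adj a b -> isolates F [set a; b]].
Proof.
move=> c0 c1 large dense.
elim/ltn_ind: {U}#|U| {-2}U (erefl #|U|) => k IH U cU.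
have [big|small] := leP (Num.sqrt n%:R) (#|U|%:R : R).
  have large_U : 640 <= c ^+ 2 * #|U|%:R.
    by rewrite mulrC -ler_pdivrMr ?exprn_gt0 // (le_trans large).
  have [C [F [CU C0 cF pathF isoF]]] := isolate_linked_part c0 c1 large_U (dense U big).
  have cC : #|U| = (#|C| + #|U :\: C|)%N by rewrite -(cardsID C U) (setIidPr CU).
  have C_gt0 : (0 < #|C|)%N by rewrite card_gt0.
  have [|F' [cF' pathF' isoF']] := IH #|U :\: C| _ (U :\: C) erefl.
    by rewrite -cU cC -{1}(add0n #|_|) ltn_add2r.
  exists (F :|: F'); split.
  - apply: (@le_trans _ _ (#|F|%:R + #|F'|%:R)).
      by rewrite -natrD ler_nat card_setU_le.
    rewrite cC natrD mulrDr -addrA; exact: lerD.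
  - by move=> P; rewrite inE => /orP[/pathF|/pathF'].
  - move=> a b aU bU ab; have [aC|aC] := boolP (a \in C).
      by apply: isolates_sub (subsetUl _ _) _; exact: isoF.
    have [bC|bC] := boolP (b \in C).
      apply: isolates_sub (subsetUl _ _) _; rewrite setUC; apply: isoF => //.
      by rewrite adj_sym.
    by apply: isolates_sub (subsetUr _ _) _; apply: isoF'; rewrite ?inE ?aC ?bC.
(* Below the threshold each edge becomes a path of its own; there are at most [#|U| ^ 2 < n] of
   them. *)
pose F := [set [set e] | e in [set e in edges adj | e \subset U]].
exists F; split.
- have n0 : 0 <= 544 / c ^+ 3 * #|U|%:R.
    by rewrite mulr_ge0 ?ler0n // divr_ge0 ?ler0n // exprn_ge0 // ltW.
  apply: (@le_trans _ _ n%:R); last by lra.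
  apply: (@le_trans _ _ ((#|U| ^ 2)%N)%:R).
    rewrite ler_nat; apply: leq_trans (leq_imset_card _ _) _.
    exact: spanned_edges_le_sqr.
  rewrite natrX -[leRHS]sqr_sqrtr ?ler0n // ler_sqr ?nnegrE ?sqrtr_ge0 ?ler0n //.
  exact: ltW.
- move=> P /imsetP[e]; rewrite !inE => /andP[/existsP[x /existsP[y]]].
  by case/andP=> xy /eqP -> _ ->; exact: is_path_edgeset1.
- move=> a b aU bU ab; have inF : [set [set a; b]] \in F.
    apply: imset_f; rewrite inE subUset !sub1set aU bU !andbT inE.
    by apply/existsP; exists a; apply/existsP; exists b; rewrite ab eqxx.
  by exists [set [set a; b]], [set [set a; b]]; rewrite setIid.
Qed.

(** If [P] and [Q] meet exactly in [e1], then one of them misses [e2] while both contain [e1]. *)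
Lemma f_sps_le_isolating (Hg : simple_graph adj) (F : {set {set {set 'I_n}}}) :
    (forall P, P \in F -> is_path_edgeset adj P) ->
    (forall e, e \in edges adj -> isolates F e) ->
  (f_sps Hg <= #|F|)%N.
Proof.
move=> pathF isoF; rewrite /f_sps; case: ex_minnP => k _; apply; apply/asboolP.
exists F; split=> //; split=> // e1 e2 /isoF[P [Q [PF QF PQ]]] _ e12.
have /setIP[e1P e1Q] : e1 \in P :&: Q by rewrite PQ set11.
have : e2 \notin P :&: Q by rewrite PQ inE eq_sym.
rewrite inE negb_and => /orP[/negbTE e2P|/negbTE e2Q].
  by exists P; rewrite // e1P e2P.
by exists Q; rewrite // e1Q e2Q.
Qed.
End Main.

Theorem theorem1p5 (R : realType) (c : R) (hc : 0 < c) :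
  exists n0 : nat, forall n : nat, (n0 <= n)%N ->
    forall (adj : rel 'I_n) (Hg : simple_graph adj),
      (forall U : {set 'I_n}, Num.sqrt (n%:R : R) <= (#|U|%:R : R) ->
         c * (#|U|%:R) ^+ 2 <= (spanned_edges adj U)%:R) ->
      ((f_sps Hg)%:R : R) <= 638 * n%:R / c ^+ 3.
Proof.
pose M : R := 640 / c ^+ 2.
have M0 : 0 < M by rewrite divr_gt0 ?exprn_gt0.
(* This threshold ensures [Num.sqrt n%:R >= 640 / c ^+ 2], so every set above the density threshold
   is large enough for a round. *)
exists (Num.truncn (M ^+ 2)).+1 => n n_large adj Hg dense.
have [adj_sym adj_irr] := Hg.
have n_M : M ^+ 2 <= n%:R.
  apply: ltW; apply: lt_le_trans (_ : (Num.truncn (M ^+ 2)).+1%:R <= _); last by rewrite ler_nat.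
  by have /andP[] := truncn_itv (sqr_ge0 M).
have n_gt0 : (0 < n)%N by apply: leq_trans n_large.
have sqrt_M : M <= Num.sqrt n%:R.
  by rewrite -(ger0_norm (ltW M0)) -sqrtr_sqr ler_wsqrtr.
have n1 : 1 <= n%:R :> R by rewrite ler1n.
have sqrt_n : Num.sqrt n%:R <= #|[set: 'I_n]|%:R :> R.
  rewrite cardsT card_ord -[leRHS]ger0_norm ?ler0n // -sqrtr_sqr ler_wsqrtr //.
  by rewrite expr2 ler_peMl ?ler0n.
(* The whole vertex set spans at most [n ^ 2] edges, so the density assumption bounds [c]. *)
have c1 : c <= 1.
  have := dense _ sqrt_n; rewrite cardsT card_ord => le_c.
  have := spanned_edges_le_sqr adj [set: 'I_n]; rewrite cardsT card_ord -(ler_nat R).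
  rewrite natrX => /(le_trans le_c); rewrite -[leRHS]mul1r ler_pM2r //.
  by rewrite exprn_gt0 // ltr0n.
have [F [cF pathF isoF]] := isolate_edges_in adj_sym adj_irr [set: 'I_n] hc c1 sqrt_M dense.
apply: (@le_trans _ _ #|F|%:R).
  rewrite ler_nat; apply: f_sps_le_isolating => // e.
  rewrite inE => /existsP[x /existsP[y /andP[xy /eqP ->]]].
  by apply: isoF; rewrite ?inE.
apply: le_trans cF _; rewrite cardsT card_ord.
pose v := c^-1; have v1 : 1 <= v by rewrite invr_ge1 ?unitfE ?gt_eqF // inE.
rewrite -[_ ^-1]exprVn -/v.
(* As [c <= 1], the leftover [n%:R] is absorbed, which gives the constant 544 + 1, below 638. *)
have : n%:R <= v ^+ 3 * n%:R by rewrite ler_peMl ?ler0n // exprn_ege1.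
lra.
Qed.
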